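(* Let $K$ be a Polish space and let $f:K\to\mathbb{R}$ be a bounded function. Then the following are equivalent: (1) $f\in \mathrm{DSC}(K)$. (2) For any closed non-empty subset $L$ of $K$, there exists a closed relative neighborhood $U$ in $L$ such that $f|_U\in \mathrm{DSC}(U)$. (3) For any closed non-empty subset $L$ of $K$, there exists a closed relative neighborhood $U$ in $L$ such that $f|_U\in \mathrm{DBSC}(U)$. (4) For any closed non-empty subset $L$ of $K$, there exist a subset $E$ of $L$ which is of second category in $L$ and a sequence $(f_j)$ of continuous real-valued functions on the closure $\overline{E}$ such that $f_j\to f$ pointwise on $\overline{E}$ and $\sum_{j=1}^\infty|f_{j+1}(t)-f_j(t)|<\infty$ for all $t\in E$.
   Context: For a separable metrizable space $X$ (in particular $K$ or a subset of $K$ with the relative topology), $C(X)$ is the class of continuous functions $X\to\mathbb{R}$. $\mathrm{DSC}(X)$ is the set of $f:X\to\mathbb{R}$ for which there is a sequence $(f_n)\subset C(X)$ with $f_n\to f$ pointwise on $X$ and $\sum_{n=1}^\infty|f_{n+1}(x)-f_n(x)|<\infty$ for every $x\in X$. $\mathrm{DBSC}(X)$ is the set of $f:X\to\mathbb{R}$ for which there exist $(\varphi_n)\subset C(X)$ and a constant $C$ with $f(x)=\sum_{n=1}^\infty\varphi_n(x)$ and $\sum_{n=1}^\infty|\varphi_n(x)|\le C$ for all $x\in X$. A closed relative neighborhood in $L$ is a closed subset $U$ of $L$ having non-empty interior relative to $L$. A subset of $L$ is of second category in $L$ if it is not meager (not a countable union of nowhere dense sets) in $L$. *)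

(* Defs.v *)
From HB Require Import structures.
From mathcomp Require Import all_boot all_order all_algebra.
From mathcomp Require Import all_classical all_reals all_analysis.

Set Implicit Arguments.
Unset Strict Implicit.
Unset Printing Implicit Defensive.

Import Order.TTheory GRing.Theory Num.Theory.
Import numFieldNormedType.Exports.

Local Open Scope classical_set_scope.
Local Open Scope ring_scope.

Definition separable_space (T : topologicalType) : Prop :=
  exists2 D : set T, countable D & dense D.

Definition is_metric (R : realType) (T : Type) (d : T -> T -> R) : Prop :=
  [/\ forall x y, d x y = 0 <-> x = y,
      forall x y, d x y = d y x &
      forall x y z, d x z <= d x y + d y z].

Definition metrizes (R : realType) (T : topologicalType)
    (d : T -> T -> R) : Prop :=
  forall (x : T) (A : set T),
    nbhs x A <-> exists2 e : R, 0 < e & [set y | d x y < e] `<=` A.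

Definition cauchy_seq (R : realType) (T : Type) (d : T -> T -> R)
    (u : nat -> T) : Prop :=
  forall e : R, 0 < e -> exists N : nat,
    forall m n : nat, (N <= m)%N -> (N <= n)%N -> d (u m) (u n) < e.

Definition complete_metric (R : realType) (T : topologicalType)
    (d : T -> T -> R) : Prop :=
  forall u : nat -> T, cauchy_seq d u -> exists l : T, u @ \oo --> l.

Definition polish_space (R : realType) (T : topologicalType) : Prop :=
  separable_space T /\
  exists d : T -> T -> R, [/\ is_metric d, metrizes d & complete_metric d].

(* A function on a subset A of T is represented by a total function on T, of
   which only the values on A matter: DSC A f and DBSC A f say that the
   restriction of f to A, with its relative topology, is in DSC(A), resp.
   DBSC(A). In particular DSC(T) is DSC [set: T]. Sequences start at 0, and
   series of absolute values are summed in the extended reals. *)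
Definition DSC (R : realType) (T : topologicalType) (A : set T)
    (f : T -> R) : Prop :=
  exists f_ : nat -> T -> R,
    [/\ forall n, {within A, continuous (f_ n)},
        forall x, A x -> f_ n x @[n --> \oo] --> f x &
        forall x, A x ->
          (\sum_(0 <= n <oo) (`|f_ n.+1 x - f_ n x|)%:E < +oo)%E].

Definition DBSC (R : realType) (T : topologicalType) (A : set T)
    (f : T -> R) : Prop :=
  exists (phi : nat -> T -> R) (C : R),
    [/\ forall n, {within A, continuous (phi n)},
        forall x, A x -> series (fun n => phi n x) @ \oo --> f x &
        forall x, A x -> (\sum_(0 <= n <oo) (`|phi n x|)%:E <= C%:E)%E].

(* In [subspace L] the points outside L are isolated, so for subsets of L the
   closure and interior taken there are those relative to L. *)
Definition closed_rel_neighborhood (T : topologicalType) (L U : set T) : Prop :=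
  [/\ U `<=` L,
      closed (U : set (subspace L)) &
      interior (U : set (subspace L)) !=set0].

Definition nowhere_dense (T : topologicalType) (A : set T) : Prop :=
  interior (closure A) = set0.

Definition meager (T : topologicalType) (A : set T) : Prop :=
  exists2 F : nat -> set T,
    forall n, nowhere_dense (F n) & A = \bigcup_n F n.

Definition second_category_in (T : topologicalType) (L E : set T) : Prop :=
  E `<=` L /\ ~ meager (E : set (subspace L)).

(* Main.v *)
Require Import Defs.
From HB Require Import structures.
From mathcomp Require Import all_boot all_order all_algebra.
From mathcomp Require Import all_classical all_reals all_analysis.
From mathcomp Require Import lra.

Set Implicit Arguments.
Unset Strict Implicit.
Unset Printing Implicit Defensive.

Import Order.TTheory GRing.Theory Num.Theory.
Import numFieldNormedType.Exports.

Local Open Scope classical_set_scope.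
Local Open Scope ring_scope.

(** Let [d] be a complete metric for [K].

    A function is in DSC(K) as soon as it is a difference [u - v] of nonnegative
    lower semicontinuous functions: the inf-convolutions of [u] and of [v] with
    multiples of [d] are continuous and increase pointwise to [u] and [v], so
    the variation of their difference telescopes ([lsc_difference_DSC]).
    Conversely, when [f] is DBSC on a closed set [C], the positive and negative
    parts of the terms of its series give such a decomposition on [C]; both
    functions are extended by the same constant, a common upper bound, which
    keeps them lower semicontinuous on [K] and makes them cancel off [C]
    ([DBSC_lsc_decomposition]). This allows gluing: if closed sets [C 0],
    [C 1], ... cover [K] and [f] is DBSC on each of them, then summing, at each
    [x], the [u]'s and the [v]'s up to the first index [n] with [C n x] gives
    lower semicontinuous functions whose difference is [f]
    ([DBSC_closed_cover_lsc]).

    A countable closed cover of this kind is obtained from the relative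
    neighborhood condition without transfinite induction. By separability, the
    union [V] of all open sets covered by countably many closed sets on which
    [f] is DBSC is itself so covered; applying the condition to the complement
    of [V], if nonempty, would yield a larger such open set
    ([DBSC_cover_setT]).

    The remaining link is the Baire category theorem. Given continuous functions
    converging to [f] on a closed set, the points where their variation,
    increased by the absolute value of the first function, is at most [n] form a
    closed set on which [f] is DBSC; if countably many of these
    sets cover a set nonmeager in [L], one of them has interior in [L]
    ([second_category_DBSC]). Conversely a closed relative neighborhood in [L]
    is itself nonmeager in [L], by completeness
    ([closed_rel_neighborhood_second_category]). *)

(** * Series of nonnegative reals and relative continuity *)

Lemma nneseries_leP (R : realType) (a : nat -> R) (M : R) :
  (forall n, 0 <= a n) ->
  (\sum_(0 <= n <oo) (a n)%:E <= M%:E)%E <->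
  (forall N, \sum_(0 <= n < N) a n <= M).
Proof.
move=> a0; split=> [le_M N|le_M].
  rewrite -lee_fin -sumEFin; apply: le_trans le_M.
  by apply: nneseries_lim_ge => n _ _; rewrite lee_fin.
apply: lime_le; first by apply: is_cvg_nneseries => n _ _; rewrite lee_fin.
by near=> N; rewrite sumEFin lee_fin.
Unshelve. all: by end_near. Qed.

Lemma nneseries_ltyP (R : realType) (a : nat -> R) :
  (forall n, 0 <= a n) ->
  (\sum_(0 <= n <oo) (a n)%:E < +oo)%E <->
  (exists M, forall N, \sum_(0 <= n < N) a n <= M).
Proof.
move=> a0; split=> [fin|[M /(nneseries_leP M a0) le_M]]; last first.
  exact: le_lt_trans le_M (ltry _).
have s_ge0 : (0 <= \sum_(0 <= n <oo) (a n)%:E)%E.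
  by apply: nneseries_ge0 => n _ _; rewrite lee_fin.
exists (fine (\sum_(0 <= n <oo) (a n)%:E)); apply/nneseries_leP => //.
by rewrite fineK // ge0_fin_numE.
Qed.

Lemma within_continuous_near_gt (R : realType) (K : topologicalType)
    (A : set K) (g : K -> R) (x : K) (a : R) :
  {within A, continuous g} -> A x -> a < g x ->
  \forall y \near x, A y -> a < g y.
Proof.
move=> /subspace_continuousP/(_ x) cg Ax agx.
exact: cvgr_gt (cg Ax) _ agx.
Qed.

Lemma within_continuous_sum (R : realType) (K : topologicalType)
    (A : set K) (g : nat -> K -> R) (N : nat) :
  (forall n, {within A, continuous (g n)}) ->
  {within A, continuous (fun x => \sum_(0 <= n < N) g n x)}.
Proof.
move=> cg; elim: N => [|N IH] x.
  rewrite (_ : from_subspace _ _ = (fun=> 0)); first exact: cvg_cst.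
  by apply/funext => y; rewrite /from_subspace big_geq.
rewrite (_ : from_subspace _ _ =
    (fun y => \sum_(0 <= n < N) g n y) + (g N : subspace A -> R)).
  by apply: cvgD; [exact: IH | exact: cg].
by apply/funext => y; rewrite /from_subspace big_nat_recr.
Qed.

Lemma within_continuous_norm (R : realType) (K : topologicalType)
    (A : set K) (g : K -> R) :
  {within A, continuous g} -> {within A, continuous (fun x => `|g x|)}.
Proof. by move=> cg x; apply: cvg_norm; exact: cg. Qed.

Lemma closed_sublevel (R : realType) (K : topologicalType)
    (A : set K) (g : K -> R) (M : R) :
  closed A -> {within A, continuous g} -> closed (A `&` [set x | g x <= M]).
Proof.
move=> cA cg; rewrite -openC openE => x /= /not_andP nAx.
have [Ax|Ax] := pselect (A x); last first.
  by apply: filterS (open_nbhs_nbhs (conj (closed_openC cA) Ax)) => y nAy [].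
have Mgx : M < g x by case: nAx => // /negP; rewrite -ltNge.
apply: filterS (within_continuous_near_gt cg Ax Mgx) => y gy [/gy + /=].
by rewrite ltNge => /negP.
Qed.

(** * Lower semicontinuous functions *)

(** Lower semicontinuity of a real-valued function, stated with values in [R]
    rather than in the extended reals. *)
Definition lsc (R : realType) (K : topologicalType) (u : K -> R) : Prop :=
  forall x a, a < u x -> \forall y \near x, a < u y.

Lemma lscD (R : realType) (K : topologicalType) (u v : K -> R) :
  lsc u -> lsc v -> lsc (fun x => u x + v x).
Proof.
move=> lu lv x a auv; pose e := (u x + v x - a) / 2.
have ux : u x - e < u x by rewrite /e; lra.
have vx : v x - e < v x by rewrite /e; lra.
near=> y.
have : u x - e < u y by near: y; exact: lu.
have : v x - e < v y by near: y; exact: lv.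
by rewrite /e; lra.
Unshelve. all: by end_near. Qed.

Lemma lsc_sum (R : realType) (K : topologicalType) (u : nat -> K -> R) N :
  (forall n, lsc (u n)) -> lsc (fun x => \sum_(0 <= n < N) u n x).
Proof.
move=> lu; elim: N => [|N IH] x a.
  by rewrite big_geq // => a0; near=> y; rewrite big_geq.
rewrite big_nat_recr //= => ax.
apply: filterS (lscD IH (lu N) ax) => y; by rewrite big_nat_recr.
Unshelve. all: by end_near. Qed.

(** A sum of continuous nonnegative functions on a closed set, extended by an
    upper bound off that set, is lower semicontinuous on the whole space. *)
Lemma lsc_series_extension (R : realType) (K : topologicalType) (A : set K)
    (psi : nat -> K -> R) (B : R) :
  closed A -> 0 <= B -> (forall n, {within A, continuous (psi n)}) ->
  (forall n x, 0 <= psi n x) ->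
  (forall x N, A x -> \sum_(0 <= n < N) psi n x <= B) ->
  exists u : K -> R,
    [/\ lsc u, forall x, 0 <= u x, forall x, ~ A x -> u x = B &
        forall x, A x -> series (psi ^~ x) @ \oo --> u x].
Proof.
move=> cA B0 cpsi psi0 psiB.
have nd x : nondecreasing_seq (series (psi ^~ x)).
  by apply/nondecreasing_seqP => n; rewrite /series /= big_nat_recr //= lerDl.
have cvgA x : A x -> cvgn (series (psi ^~ x)).
  move=> Ax; apply: nondecreasing_is_cvgn (nd x) _.
  by exists B => _ [N _ <-]; exact: psiB.
pose u x := if x \in A then limn (series (psi ^~ x)) else B.
have uA x : A x -> u x = limn (series (psi ^~ x)).
  by move=> ?; rewrite /u mem_set.
have uN x : ~ A x -> u x = B by move=> ?; rewrite /u memNset.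
have u_le x : u x <= B.
  have [Ax|Ax] := pselect (A x); last by rewrite uN.
  rewrite uA //; apply: limr_le; first exact: cvgA.
  by near=> N; exact: psiB.
have u_ge x N : A x -> \sum_(0 <= n < N) psi n x <= u x.
  move=> Ax; rewrite uA //.
  exact: nondecreasing_cvgn_le (nd x) (cvgA x Ax) N.
exists u; split=> [x a au|x|//|x Ax]; last by rewrite uA //; exact: cvgA.
- have [Ax|Ax] := pselect (A x); last first.
    rewrite uN // in au.
    apply: filterS (open_nbhs_nbhs (conj (closed_openC cA) Ax)) => y nAy.
    by rewrite uN.
  have : a < limn (series (psi ^~ x)) by rewrite -uA.
  move=> /(cvgr_gt _ (cvgA x Ax)) [N _ /(_ N (leqnn N)) aN].
  have cN := within_continuous_sum (N := N) cpsi.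
  apply: filterS (within_continuous_near_gt cN Ax aN) => y ay.
  have [Ay|Ay] := pselect (A y); first exact: lt_le_trans (ay Ay) (u_ge _ _ Ay).
  by rewrite uN //; exact: lt_le_trans au (u_le x).
- have [Ax|Ax] := pselect (A x); last by rewrite uN.
  by apply: le_trans (u_ge x 0%N Ax); rewrite big_geq.
Unshelve. all: by end_near. Qed.

(** Splitting each term of the series of [f] into positive and negative parts
    writes [f] as a difference of two nonnegative lower semicontinuous
    functions, which moreover agree off [A]. *)
Lemma DBSC_lsc_decomposition (R : realType) (K : topologicalType) (A : set K)
    (f : K -> R) :
  closed A -> DBSC A f ->
  exists u v : K -> R,
    [/\ lsc u /\ lsc v, forall x, 0 <= u x /\ 0 <= v x,
        forall x, A x -> f x = u x - v x & forall x, ~ A x -> u x = v x].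
Proof.
move=> cA [phi [C [cphi phif phiC]]].
pose pos n x := (`|phi n x| + phi n x) / 2.
pose neg n x := (`|phi n x| - phi n x) / 2.
have pos0 n x : 0 <= pos n x.
  by rewrite /pos; have := ler_norm (- phi n x); rewrite normrN; lra.
have neg0 n x : 0 <= neg n x.
  by rewrite /neg; have := ler_norm (phi n x); lra.
have absE n x : `|phi n x| = pos n x + neg n x by rewrite /pos /neg; lra.
have phiE n x : phi n x = pos n x - neg n x by rewrite /pos /neg; lra.
have abs_le x N : A x -> \sum_(0 <= n < N) `|phi n x| <= `|C|.
  move=> Ax; apply: le_trans (ler_norm C).
  by move: N; apply/nneseries_leP; [|exact: phiC].
have cpos n : {within A, continuous (pos n)}.
  move=> x; apply: cvgM; last exact: cvg_cst.
  by apply: cvgD; [exact: within_continuous_norm|exact: cphi].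
have cneg n : {within A, continuous (neg n)}.
  move=> x; apply: cvgM; last exact: cvg_cst.
  by apply: cvgB; [exact: within_continuous_norm|exact: cphi].
have posB x N : A x -> \sum_(0 <= n < N) pos n x <= `|C|.
  move=> Ax; apply: le_trans (abs_le x N Ax); apply: ler_sum => n _.
  by rewrite absE lerDl.
have negB x N : A x -> \sum_(0 <= n < N) neg n x <= `|C|.
  move=> Ax; apply: le_trans (abs_le x N Ax); apply: ler_sum => n _.
  by rewrite absE lerDr.
have [u [lu u0 uN uA]] := lsc_series_extension cA (normr_ge0 C) cpos pos0 posB.
have [v [lv v0 vN vA]] := lsc_series_extension cA (normr_ge0 C) cneg neg0 negB.
exists u, v; split=> // [x Ax|x Ax]; last by rewrite uN // vN.
apply: (@cvg_unique _ (@norm_hausdorff _ _) _ _ _ _ (phif x Ax)).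
rewrite (_ : series _ = series (pos ^~ x) - series (neg ^~ x)).
  by apply: cvgB; [exact: uA|exact: vA].
apply/funext => N; rewrite /series /= -[RHS]/(_ - _) -sumrB.
by apply: eq_bigr.
Qed.

(** * Gluing along a countable closed cover *)

(** Here [N x] is the index of the first set of a closed cover [C] that
    contains [x]; it is lower semicontinuous, so the sum of the first
    [N x] + 1 functions is too. *)
Lemma lsc_first_index_sum (R : realType) (K : topologicalType)
    (C : nat -> set K) (N : K -> nat) (u : nat -> K -> R) :
  (forall n, closed (C n)) -> (forall x m, (m < N x)%N -> ~ C m x) ->
  (forall x, C (N x) x) ->
  (forall n, lsc (u n)) -> (forall n x, 0 <= u n x) ->
  lsc (fun x => \sum_(0 <= m < (N x).+1) u m x).
Proof.
move=> cC Nmin CN lu u0 x a ax.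
have far : \forall y \near x, forall m, (m < N x)%N -> ~ C m y.
  elim: (N x) (Nmin x) => [|k IH] kmin; first by near=> y.
  near=> y => m; rewrite ltnS leq_eqVlt => /orP[/eqP ->|mk].
    near: y; apply: open_nbhs_nbhs; split; first exact: closed_openC.
    exact: kmin (ltnSn k).
  suff: forall m, (m < k)%N -> ~ C m y by exact.
  by near: y; apply: IH => j jk; exact: kmin (ltnW jk).
have near_sum : \forall y \near x, a < \sum_(0 <= m < (N x).+1) u m y.
  exact: lsc_sum.
apply: filterS2 far near_sum => y nC ay.
have NN : (N x <= N y)%N by rewrite leqNgt; apply/negP => /nC; apply; exact: CN.
apply: lt_le_trans ay _.
rewrite [leRHS](big_cat_nat (n := (N x).+1)) //= lerDl.
by apply: sumr_ge0 => i _; exact: u0.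
Unshelve. all: by end_near. Qed.

(** Each set [C n] contributes to the sums only off [C 0], ..., [C n.-1], and
    its two functions cancel off [C n]; so at [x] only the first set containing
    [x] contributes to the difference, namely [f x]. *)
Lemma DBSC_closed_cover_lsc (R : realType) (K : topologicalType) (f : K -> R)
    (C : nat -> set K) :
  (forall n, closed (C n)) -> (forall n, DBSC (C n) f) ->
  (forall x, exists n, C n x) ->
  exists u v : K -> R,
    [/\ lsc u /\ lsc v, forall x, 0 <= u x /\ 0 <= v x &
        forall x, f x = u x - v x].
Proof.
move=> cC fC Ccov.
have exC x : exists n, `[< C n x >].
  by have [n ?] := Ccov x; exists n; exact/asboolP.
pose N x := ex_minn (exC x).
have CN x : C (N x) x by rewrite /N; case: ex_minnP => m /asboolP.
have Nmin x m : (m < N x)%N -> ~ C m x.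
  rewrite /N; case: ex_minnP => k _ kmin mk Cm.
  by have := kmin m; rewrite leqNgt mk => /(_ (asboolT Cm)).
have [u /choice[v uv]] := choice (fun n => DBSC_lsc_decomposition (cC n) (fC n)).
exists (fun x => \sum_(0 <= m < (N x).+1) u m x),
  (fun x => \sum_(0 <= m < (N x).+1) v m x); split.
- split; apply: (lsc_first_index_sum cC) => // n;
    by [case: (uv n) => -[] | move=> x; case: (uv n) => _ /(_ x)[]].
- by move=> x; split; apply: sumr_ge0 => n _; case: (uv n) => _ /(_ x)[].
- move=> x; rewrite -sumrB big_nat_recr //= big1_seq.
    by rewrite add0r; case: (uv (N x)) => _ _ /(_ x (CN x)).
  move=> m; rewrite mem_index_iota /= => mN.
  by case: (uv m) => _ _ _ /(_ x (Nmin x m mN)) ->; rewrite subrr.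
Qed.

(** * Lipschitz approximation from below *)

(** The inf-convolution of [u] with [n] times the distance: when [u] is bounded
    below, the largest [n]-Lipschitz function below [u]. *)
Definition inf_convolution (R : realType) (K : Type) (d : K -> K -> R)
    (u : K -> R) (n : nat) (x : K) : R :=
  inf [set u y + n%:R * d x y | y in [set: K]].

Lemma metric_ge0 (R : realType) (K : Type) (d : K -> K -> R) :
  is_metric d -> forall x y, 0 <= d x y.
Proof.
move=> [d0 dC dT] x y; have := dT x y x; rewrite (dC y x).
by rewrite (d0 x x).2 //; lra.
Qed.

Section InfConvolution.
Variables (R : realType) (K : topologicalType) (d : K -> K -> R).
Hypotheses (md : is_metric d) (dK : metrizes d).
Variables (u : K -> R) (u0 : forall x, 0 <= u x).

Let d_ge0 := metric_ge0 md.
Local Notation g := (inf_convolution d u).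

Lemma inf_convolution_lbound n x y : g n x <= u y + n%:R * d x y.
Proof.
apply: ge_inf; last by exists y.
by exists 0 => _ [z _ <-]; rewrite addr_ge0 // mulr_ge0.
Qed.

Lemma inf_convolution_ge n x a :
  (forall y, a <= u y + n%:R * d x y) -> a <= g n x.
Proof.
move=> le_a; apply: lb_le_inf; first by exists (u x + n%:R * d x x), x.
by move=> _ [y _ <-].
Qed.

Lemma inf_convolution_le n x : g n x <= u x.
Proof.
have [d0 _ _] := md.
apply: le_trans (inf_convolution_lbound n x x) _.
by rewrite (d0 x x).2 // mulr0 addr0.
Qed.

Lemma inf_convolution_ge0 n x : 0 <= g n x.
Proof. by apply: inf_convolution_ge => y; rewrite addr_ge0 // mulr_ge0. Qed.

Lemma inf_convolution_nondecreasing n x : g n x <= g n.+1 x.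
Proof.
apply: inf_convolution_ge => y; apply: le_trans (inf_convolution_lbound n x y) _.
by rewrite lerD2l ler_wpM2r // ler_nat.
Qed.

Lemma inf_convolution_lipschitz n x z : g n z <= g n x + n%:R * d x z.
Proof.
have [_ dC dT] := md.
rewrite -lerBlDr; apply: inf_convolution_ge => y; rewrite lerBlDr.
apply: le_trans (inf_convolution_lbound n z y) _.
by rewrite -addrA lerD2l -mulrDr ler_wpM2l // addrC (dC x z).
Qed.

Lemma inf_convolution_continuous n : continuous (g n).
Proof.
move=> x; apply/cvgrPdist_lt => e e0; apply/dK.
exists (e / n.+1%:R); first by rewrite divr_gt0.
move=> y /=; rewrite ltr_pdivlMr // => dxy.
have [_ dC _] := md.
have le_e : n%:R * d x y < e.
  by apply: le_lt_trans dxy; rewrite mulrC ler_wpM2l // ler_nat.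
have := inf_convolution_lipschitz n x y; have := inf_convolution_lipschitz n y x.
by rewrite (dC y x) ltr_norml => ? ?; apply/andP; split; lra.
Qed.

(** If [d x y] is small then [u y] is almost [u x] by lower semicontinuity;
    otherwise [n%:R * d x y] exceeds [u x] for large [n]. *)
Lemma inf_convolution_cvg : lsc u -> forall x, g n x @[n --> \oo] --> u x.
Proof.
move=> lu x; apply/cvgrPdist_le => e e0.
have /dK[r r0 ur] : \forall y \near x, u x - e < u y by apply: lu; lra.
near=> n.
have nr : u x <= n%:R * r.
  rewrite -ler_pdivrMr //; near: n; exact: nbhs_infty_ger.
have := inf_convolution_le n x.
suff : u x - e <= g n x by rewrite ler_norml => ? ?; apply/andP; split; lra.
apply: inf_convolution_ge => y; have [xy|yx] := ltP (d x y) r.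
  have := ur y xy; rewrite /=.
  by have : 0 <= n%:R * d x y by [rewrite mulr_ge0]; lra.
have : n%:R * r <= n%:R * d x y by rewrite ler_wpM2l.
by have := u0 y; lra.
Unshelve. all: by end_near. Qed.

End InfConvolution.

(** The two sequences of inf-convolutions increase, so the variation of their
    difference telescopes and is at most [u x + v x]. *)
Lemma lsc_difference_DSC (R : realType) (K : topologicalType)
    (d : K -> K -> R) (f u v : K -> R) :
  is_metric d -> metrizes d -> lsc u -> lsc v ->
  (forall x, 0 <= u x /\ 0 <= v x) -> (forall x, f x = u x - v x) ->
  DSC [set: K] f.
Proof.
move=> md dK lu lv uv0 fE.
have u0 x : 0 <= u x by case: (uv0 x).
have v0 x : 0 <= v x by case: (uv0 x).
pose U := inf_convolution d u; pose V := inf_convolution d v.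
exists (fun n x => U n x - V n x); split.
- move=> n; apply: continuous_subspaceT => x.
  by apply: cvgB; exact: inf_convolution_continuous.
- by move=> x _; rewrite fE; apply: cvgB; exact: (inf_convolution_cvg md dK).
- move=> x _; apply/nneseries_ltyP => //; exists (u x + v x) => N.
  have UN := inf_convolution_le md u0 N x.
  have VN := inf_convolution_le md v0 N x.
  have U0 := inf_convolution_ge0 md u0 0 x.
  have V0 := inf_convolution_ge0 md v0 0 x.
  apply: le_trans (_ : (U N x - U 0 x) + (V N x - V 0 x) <= _).
    rewrite -(telescope_sumr (U ^~ x)) // -(telescope_sumr (V ^~ x)) //.
    rewrite -big_split /=.
    apply: ler_sum => n _.
    have : U n x <= U n.+1 x by exact: inf_convolution_nondecreasing.
    have : V n x <= V n.+1 x by exact: inf_convolution_nondecreasing.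
    by move=> ? ?; rewrite ler_norml; apply/andP; split; lra.
  by rewrite /U /V; lra.
Qed.

(** * From a relative neighborhood condition to a countable closed cover *)

(** [A] is covered by countably many closed sets on each of which [f] is
    DBSC. *)
Definition DBSC_cover (R : realType) (K : topologicalType) (f : K -> R)
    (A : set K) : Prop :=
  exists S : set (set K),
    [/\ countable S, forall C, S C -> closed C /\ DBSC C f &
        A `<=` \bigcup_(C in S) C].

Lemma DBSC_coverS (R : realType) (K : topologicalType) (f : K -> R)
    (A B : set K) : A `<=` B -> DBSC_cover f B -> DBSC_cover f A.
Proof.
by move=> AB [S [cS fS BS]]; exists S; split=> //; exact: subset_trans BS.
Qed.

Lemma DBSC_cover_bigcup (R : realType) (K : topologicalType) (f : K -> R)
    (I : Type) (D : set I) (A : I -> set K) :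
  countable D -> (forall i, D i -> DBSC_cover f (A i)) ->
  DBSC_cover f (\bigcup_(i in D) A i).
Proof.
move=> cD fA.
have /choice[S HS] : forall i, exists S : set (set K), D i ->
    [/\ countable S, forall C, S C -> closed C /\ DBSC C f &
        A i `<=` \bigcup_(C in S) C].
  move=> i; have [Di|nDi] := pselect (D i); last by exists set0.
  by have [S ?] := fA i Di; exists S.
exists (\bigcup_(i in D) S i); split.
- by apply: bigcup_countable => // i /HS[].
- by move=> C [i /HS[_ + _]]; exact.
- move=> x [i Di]; have [_ _ /[apply]] := HS i Di.
  by case=> C SC Cx; exists C => //; exists i.
Qed.

Lemma DBSC_cover_closed (R : realType) (K : topologicalType) (f : K -> R)
    (C : set K) : closed C -> DBSC C f -> DBSC_cover f C.
Proof.
move=> cC fC; exists [set C]; split=> [|_ ->//|x Cx]; last by exists C.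
exact: countable1.
Qed.

Lemma DBSC_coverU (R : realType) (K : topologicalType) (f : K -> R)
    (A B : set K) :
  DBSC_cover f A -> DBSC_cover f B -> DBSC_cover f (A `|` B).
Proof.
move=> fA fB; apply: (@DBSC_coverS _ _ _ _
    (\bigcup_(b in [set: bool]) (if b then A else B))).
  by move=> x [Ax|Bx]; [exists true|exists false].
by apply: DBSC_cover_bigcup => [|[]].
Qed.

Lemma closed_rel_neighborhood_closed (K : topologicalType) (L U : set K) :
  closed L -> closed_rel_neighborhood L U -> closed U.
Proof.
by move=> cL [UL cU _]; rewrite -(setIidl UL) closed_setIS.
Qed.

Lemma closed_rel_neighborhood_open (K : topologicalType) (L U : set K) :
  closed_rel_neighborhood L U ->
  exists W, [/\ open W, W `&` L !=set0 & W `&` L `<=` U].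
Proof.
move=> [UL cU [x Ux]].
have Lx : L x by apply: UL; exact: (@interior_subset (subspace L)) Ux.
have [V Vx UV] := (nbhs_subspace_ex _ Lx).1 Ux.
exists V°; split; [exact: open_interior|by exists x|].
rewrite -[X in _ `<=` X](setIidl UL) UV; apply: setSI.
exact: interior_subset.
Qed.

(** In a separable metric space the union [V] of all open sets with a countable
    DBSC cover has such a cover; a relative neighborhood in the complement of
    [V] would contradict the maximality of [V], so [V] is the whole space. *)
Lemma DBSC_cover_setT (R : realType) (K : topologicalType)
    (d : K -> K -> R) (f : K -> R) :
  separable_space K -> is_metric d -> metrizes d ->
  (forall L : set K, closed L -> L !=set0 ->
     exists2 U : set K, closed_rel_neighborhood L U & DBSC U f) ->
  DBSC_cover f [set: K].
Proof.
move=> [D cD dD] [d0 dC dT] dK rel.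
pose b (p : K * nat) := [set y | d p.1 y < p.2.+1%:R^-1].
pose I := (D `*` [set: nat]) `&` [set p | DBSC_cover f (b p)].
pose V := \bigcup_(p in I) (b p).
have fV : DBSC_cover f V.
  apply: DBSC_cover_bigcup => [|p []//].
  apply: (@sub_countable _ _ _ (D `*` [set: nat])).
    by apply: subset_card_le; exact: subIsetl.
  by apply: countableX.
have Vmax W : open W -> DBSC_cover f W -> W `<=` V.
  move=> oW fW x Wx.
  have /dK[e e0 eW] : nbhs x W by exact: open_nbhs_nbhs.
  have e2 : 0 < e / 2 by rewrite divr_gt0.
  (* The ball of radius [r] about [q] contains [x], and it lies in the ball of
     radius [e] about [x] because [2 * r < e]. *)
  have [k _ /(_ k (leqnn k)) ke] := near_infty_natSinv_lt (PosNum e2).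
  have /= {}ke : k.+1%:R^-1 < e / 2 := ke.
  pose r : R := k.+1%:R^-1; have r0 : 0 < r by rewrite invr_gt0.
  have nx : nbhs x [set y | d x y < r] by apply/dK; exists r.
  have [q [qr Dq]] : [set y | d x y < r]° `&` D !=set0.
    by apply: dD; [exists x; exact: nx | exact: open_interior].
  have {}qr : d x q < r := interior_subset qr.
  exists (q, k); last by rewrite /b /= dC.
  split=> //=; apply: DBSC_coverS fW => y; rewrite /b /= => qy; apply: eW => /=.
  by have := dT x q y; rewrite -/r in ke qy *; lra.
have [<-//|VT] := pselect (V = [set: K]); exfalso.
have oV : open V.
  rewrite openE => x [p Ip bx]; apply/dK; exists (p.2.+1%:R^-1 - d p.1 x).
    by rewrite subr_gt0.
  move=> y /= xy; exists p => //; rewrite /b /=.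
  by rewrite (le_lt_trans (dT p.1 x y)) // addrC -ltrBrDr.
have L0 : ~` V !=set0.
  by apply/set0P/eqP => V0; apply: VT; rewrite -(setCK V) V0 setC0.
have cL := open_closedC oV.
have [U nU fU] := rel _ cL L0.
have [W [oW [x [Wx nVx]] WU]] := closed_rel_neighborhood_open nU.
apply: nVx; apply: (Vmax W) => //.
apply: (@DBSC_coverS _ _ _ _ (V `|` U)).
  move=> y Wy; have [Vy|nVy] := pselect (V y); first by left.
  by right; exact: WU.
apply: DBSC_coverU => //; apply: DBSC_cover_closed => //.
exact: closed_rel_neighborhood_closed nU.
Qed.

Lemma DBSC_set0 (R : realType) (K : topologicalType) (f : K -> R) : DBSC set0 f.
Proof. by exists (fun _ _ => 0), 0; split=> // n; exact: continuous_subspace0. Qed.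

Lemma DBSC_cover_sequence (R : realType) (K : topologicalType) (f : K -> R) :
  DBSC_cover f [set: K] ->
  exists C : nat -> set K,
    [/\ forall n, closed (C n), forall n, DBSC (C n) f &
        forall x, exists n, C n x].
Proof.
move=> [S [/pfcard_geP[S0|[F]] fS Sx]].
  have K0 (x : K) : False by have [C] := Sx x I; rewrite S0.
  exists (fun=> set0); split=> [n|n|x]; [exact: closed0|exact: DBSC_set0|].
  by case: (K0 x).
have SF n : S (F n) by apply: (@funS _ _ [set: nat] S F).
exists F; split=> [n|n|x]; try by have [] := fS _ (SF n).
have [C SC Cx] := Sx x I; have [n _ nC] := @surj _ _ [set: nat] S F C SC.
by exists n; rewrite nC.
Qed.

(** * Levels of the variation *)

Lemma DBSC_DSC (R : realType) (K : topologicalType) (A : set K) (f : K -> R) :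
  DBSC A f -> DSC A f.
Proof.
move=> [phi [C [cphi phif phiC]]].
exists (fun n x => series (phi ^~ x) n); split=> [n|//|x Ax].
  exact: within_continuous_sum.
under eq_eseriesr => n _.
  rewrite /series /= big_nat_recr //= addrAC subrr add0r; over.
exact: le_lt_trans (phiC x Ax) (ltry C).
Qed.

(** The points of [A] where the variation of the sequence is bounded by [M].
    The absolute value of the initial term is included, so that the telescoping
    series starting with [f_ 0] is absolutely bounded there. *)
Definition variation_le (R : realType) (K : Type) (A : set K)
    (f_ : nat -> K -> R) (M : R) : set K :=
  [set x | A x /\ forall N,
     `|f_ 0 x| + \sum_(0 <= j < N) `|f_ j.+1 x - f_ j x| <= M].

Lemma variation_le_closed (R : realType) (K : topologicalType) (A : set K)
    (f_ : nat -> K -> R) (M : R) :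
  closed A -> (forall j, {within A, continuous (f_ j)}) ->
  closed (variation_le A f_ M).
Proof.
move=> cA cf.
rewrite (_ : variation_le A f_ M = \bigcap_N (A `&` [set x |
    `|f_ 0 x| + \sum_(0 <= j < N) `|f_ j.+1 x - f_ j x| <= M])); last first.
  apply/seteqP; split=> x; first by move=> [Ax xM] N _; split; [|exact: xM].
  by move=> H; split=> [|N]; [have [] := H 0 I|have [] := H N I].
apply: closed_bigI => N _; apply: closed_sublevel => // x.
apply: cvgD; first exact: within_continuous_norm.
apply: (within_continuous_sum (g := fun j x => `|f_ j.+1 x - f_ j x|)) => j.
by apply: within_continuous_norm => y; apply: cvgB; exact: cf.
Qed.

Lemma variation_le_DBSC (R : realType) (K : topologicalType) (A : set K)
    (f_ : nat -> K -> R) (f : K -> R) (M : R) :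
  (forall j, {within A, continuous (f_ j)}) ->
  (forall x, A x -> f_ j x @[j --> \oo] --> f x) ->
  DBSC (variation_le A f_ M) f.
Proof.
move=> cf ff.
pose phi n x := if n is m.+1 then f_ m.+1 x - f_ m x else f_ 0 x.
exists phi, M; split=> [n|x [Ax _]|x [Ax xM]].
- apply: (@continuous_subspaceW _ _ _ A) => [x []//|].
  by case: n => [|n] x; [exact: cf|apply: cvgB; exact: cf].
- rewrite -cvg_shiftS (_ : (fun n => _) = f_ ^~ x); first exact: ff.
  apply/funext => n; rewrite /series /= big_nat_recl //= telescope_sumr //.
  by rewrite addrC subrK.
- apply/nneseries_leP => // -[|N]; last by rewrite big_nat_recl.
  by rewrite big_geq //; have := xM 0; rewrite big_geq // addr0; exact: le_trans.
Qed.

(** [f] is a pointwise limit of continuous functions on the closure of some set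
    nonmeager in [L]; the variation is required to be finite at the points of
    that set, not on its closure. *)
Definition second_category_DSC (R : realType) (K : topologicalType) (L : set K)
    (f : K -> R) : Prop :=
  exists2 E : set K, second_category_in L E &
    exists f_ : nat -> K -> R,
      [/\ forall j, {within closure E, continuous (f_ j)},
          forall t, closure E t -> f_ j t @[j --> \oo] --> f t &
          forall t, E t ->
            (\sum_(0 <= j <oo) (`|f_ j.+1 t - f_ j t|)%:E < +oo)%E].

(** Some bounded-variation level of a sequence witnessing the second-category
    condition has nonempty relative interior, because countably many of them
    cover the nonmeager set. *)
Lemma second_category_DBSC (R : realType) (K : topologicalType) (f : K -> R)
    (L : set K) :
  closed L -> second_category_DSC L f ->
  exists2 U : set K, closed_rel_neighborhood L U & DBSC U f.
Proof.
move=> cL [E [EL nmE] [f_ [cf ff fin]]].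
pose F (n : nat) := variation_le (closure E) f_ n%:R.
have cF n : closed (F n) by apply: variation_le_closed => //; exact: closed_closure.
have FL n : F n `<=` L.
  by move=> x [Ex _]; rewrite ((closure_id L).1 cL); exact: closureS Ex.
have [n Fn] : exists n, interior (F n : set (subspace L)) !=set0.
  apply: contrapT => /forallNP nF; apply: nmE.
  exists (fun n => E `&` F n).
    move=> n; rewrite /nowhere_dense; apply/eqP/negPn/negP => /set0P[x xE].
    apply: (nF n); exists x; move: xE; apply: (@interiorS (subspace L)).
    have cFn : closed (F n : set (subspace L)) by exact: closed_subspaceW.
    rewrite [X in _ `<=` X](closure_id (F n : set (subspace L))).1 //.
    by apply: closureS; exact: subIsetr.
  apply/seteqP; split=> [x Ex|x [n _ []//]].
  have /nneseries_ltyP[//|M xM] := fin x Ex.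
  exists (Num.truncn (`|f_ 0 x| + M)).+1 => //; split=> //; split=> [|N].
    exact: subset_closure.
  apply: le_trans (ltW (truncnS_gt _)); by rewrite lerD2l.
exists (F n); last exact: variation_le_DBSC.
by split=> //; exact: closed_subspaceW.
Qed.

(** * Relative Baire category theorem *)

(** Off a relatively nowhere dense set [F], every ball centred in [L] contains
    an arbitrarily small closed ball, again centred in [L], that misses [F]. *)
Lemma nowhere_dense_shrink (R : realType) (K : topologicalType)
    (d : K -> K -> R) (L F : set K) (x : K) (r e : R) :
  is_metric d -> metrizes d -> F `<=` L ->
  nowhere_dense (F : set (subspace L)) -> L x -> 0 < r -> 0 < e ->
  exists p : K * R, [/\ L p.1, 0 < p.2, p.2 <= e &
    forall y, d p.1 y <= p.2 -> d x y <= r /\ ~ F y].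
Proof.
move=> [d0 dC dT] dK FL ndF Lx r0 e0.
have [z [Lz xz nFz]] : exists z, [/\ L z, d x z < r / 2 &
    ~ closure (F : set (subspace L)) z].
  apply: contrapT => /forallNP H.
  suff: interior (closure (F : set (subspace L))) x by rewrite ndF.
  rewrite /interior /= /nbhs /= -nbhs_subspace_in //.
  apply/dK; exists (r / 2); first by rewrite divr_gt0.
  by move=> y xy Ly; apply: contrapT => nF; exact: (H y).
have nFz' : ~ closure F z.
  by move=> Fz; apply: nFz; rewrite closure_subspaceW.
have /dK[s s0 sF] : nbhs z (~` closure F).
  by apply: open_nbhs_nbhs; split=> //; exact/closed_openC/closed_closure.
pose t := Num.min (s / 2) (Num.min (r / 2) e).
have ts : t <= s / 2 by rewrite /t ge_min lexx.
have tr : t <= r / 2 by rewrite /t !ge_min lexx orbT.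
have te : t <= e by rewrite /t !ge_min lexx !orbT.
have t0 : 0 < t by rewrite /t !lt_min e0 !divr_gt0.
exists (z, t); split=> //= y zy; split; first by have := dT x z y; lra.
move=> Fy; apply: (sF y) => /=; first by lra.
exact: subset_closure.
Qed.

(** A closed subset [L] of a completely metrizable space is a Baire space, so a
    set with nonempty interior relative to [L] is not meager in [L]: a sequence
    of nested balls centred in [L] and avoiding the nowhere dense sets one after
    the other shrinks to a point of [L] that lies in none of them. *)
Lemma closed_rel_neighborhood_second_category (R : realType)
    (K : topologicalType) (d : K -> K -> R) (L U : set K) :
  is_metric d -> metrizes d -> complete_metric d ->
  closed L -> closed_rel_neighborhood L U -> second_category_in L U.
Proof.
move=> md dK dcomp cL nU; have [d0 dC dT] := md; have [UL _ _] := nU.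
split=> // -[F ndF UF].
have FL n : F n `<=` L by move=> y Fy; apply: UL; rewrite UF; exists n.
have [W [oW [x0 [Wx0 Lx0]] WU]] := closed_rel_neighborhood_open nU.
have /dK[r0 r0_gt0 r0W] : nbhs x0 W by exact: open_nbhs_nbhs.
have /choice[step stepP] : forall q : nat * (K * R), exists p : K * R,
    L q.2.1 -> 0 < q.2.2 ->
    [/\ L p.1, 0 < p.2, p.2 <= q.1.+1%:R^-1 &
      forall y, d p.1 y <= p.2 -> d q.2.1 y <= q.2.2 /\ ~ F q.1 y].
  move=> [n [x r]] /=; have [Lx|?] := pselect (L x); last by exists (x, r).
  have [r_gt0|?] := pselect (0 < r); last by exists (x, r).
  have n0 : 0 < n.+1%:R^-1 :> R by rewrite invr_gt0.
  have [p ?] := nowhere_dense_shrink md dK (FL n) (ndF n) Lx r_gt0 n0.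
  by exists p.
(* The radius is halved because [r0W] concerns an open ball. *)
pose fix P n := if n is m.+1 then step (m, P m) else (x0, r0 / 2).
have PL n : L (P n).1 /\ 0 < (P n).2.
  elim: n => [|n [Ln rn]] /=; first by rewrite divr_gt0.
  by have [] := stepP (n, P n) Ln rn.
have Pr n : (P n.+1).2 <= n.+1%:R^-1.
  by have [Ln rn] := PL n; have [] := stepP (n, P n) Ln rn.
have PS n y : d (P n.+1).1 y <= (P n.+1).2 ->
    d (P n).1 y <= (P n).2 /\ ~ F n y.
  by have [Ln rn] := PL n; have [_ _ _] := stepP (n, P n) Ln rn; apply.
have nest n m y : (n <= m)%N -> d (P m).1 y <= (P m).2 ->
    d (P n).1 y <= (P n).2.
  move=> /subnKC <-; elim: (m - n)%N => [|k IH]; rewrite ?addn0 // addnS.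
  by move=> /PS[/IH].
have centers n m : (n <= m)%N -> d (P n).1 (P m).1 <= (P n).2.
  move=> nm; apply: (nest _ _ _ nm); rewrite (d0 _ _).2 //.
  by have [_ /ltW] := PL m.
have [l Pl] : exists l : K, (fun n => (P n).1) @ \oo --> l.
  apply: dcomp => e e0.
  have e2 : 0 < e / 2 by rewrite divr_gt0.
  have [k _ /(_ k (leqnn k)) ke] := near_infty_natSinv_lt (PosNum e2).
  have {}ke : (P k.+1).2 < e / 2 := le_lt_trans (Pr k) ke.
  exists k.+1 => m n km kn.
  have := centers _ _ km; have := centers _ _ kn.
  by have := dT (P m).1 (P k.+1).1 (P n).1; rewrite (dC (P m).1 (P k.+1).1); lra.
have cvgP' e : 0 < e -> \forall n \near \oo, d l (P n).1 < e.
  by move=> e0; apply: (Pl [set y | d l y < e]); apply/dK; exists e.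
have in_ball n : d (P n).1 l <= (P n).2.
  rewrite leNgt; apply/negP => lt_d.
  have /cvgP'[m _ /(_ (maxn m n) (leq_maxl _ _)) /= dm] :
    0 < d (P n).1 l - (P n).2 by rewrite subr_gt0.
  have := centers n (maxn m n) (leq_maxr _ _).
  by have := dT (P n).1 (P (maxn m n)).1 l; rewrite (dC (P (maxn m n)).1 l); lra.
have Ll : L l.
  apply: contrapT => nLl.
  have /Pl[m _ /(_ m (leqnn m)) nLm] : nbhs l (~` L).
    by apply: open_nbhs_nbhs; split=> //; exact: closed_openC.
  by apply: nLm; have [] := PL m.
have : U l.
  apply: WU; split=> //; apply: r0W => /=; have /= := in_ball 0.
  by lra.
by rewrite UF => -[n _ Fl]; have [_] := PS n l (in_ball n.+1); apply.
Qed.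

Lemma DSC_second_category (R : realType) (K : topologicalType)
    (d : K -> K -> R) (f : K -> R) (L U : set K) :
  is_metric d -> metrizes d -> complete_metric d ->
  closed L -> closed_rel_neighborhood L U -> DSC U f ->
  second_category_DSC L f.
Proof.
move=> md dK dcomp cL nU [f_ [cf ff fin]]; exists U.
  exact: closed_rel_neighborhood_second_category dcomp cL nU.
exists f_; have /closure_id <- := closed_rel_neighborhood_closed cL nU.
by split.
Qed.

(** * The equivalence *)

Theorem theorem4p5 (R : realType) (K : topologicalType)
    (K_polish : polish_space R K) (f : K -> R)
    (f_bounded : [bounded f x | x in [set: K]]) :
  [<-> DSC [set: K] f;
       forall L : set K, closed L -> L !=set0 ->
         exists2 U : set K, closed_rel_neighborhood L U & DSC U f;
       forall L : set K, closed L -> L !=set0 ->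
         exists2 U : set K, closed_rel_neighborhood L U & DBSC U f;
       forall L : set K, closed L -> L !=set0 ->
         exists2 E : set K, second_category_in L E &
           exists f_ : nat -> K -> R,
             [/\ forall j, {within closure E, continuous (f_ j)},
                 forall t, closure E t -> f_ j t @[j --> \oo] --> f t &
                 forall t, E t ->
                   (\sum_(0 <= j <oo) (`|f_ j.+1 t - f_ j t|)%:E < +oo)%E]].
Proof.
have [sepK [d [md dK dcomp]]] := K_polish.
tfae.
- move=> [f_ [cf ff fin]] L cL [x Lx]; exists L.
    split=> //; first exact: closed_subspaceT.
    by exists x; exact: open_subspaceT.
  exists f_; split=> [n|y _|y _]; [|exact: ff|exact: fin].
  exact: continuous_subspaceW (cf n).
- move=> H L cL L0; have [U nU fU] := H L cL L0.
  by apply: second_category_DBSC => //; exact: (DSC_second_category md dK dcomp cL nU fU).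
- move=> H L cL L0; have [U nU /DBSC_DSC fU] := H L cL L0.
  exact: (DSC_second_category md dK dcomp cL nU fU).
- move=> H.
  have rel (L : set K) : closed L -> L !=set0 ->
      exists2 U : set K, closed_rel_neighborhood L U & DBSC U f.
    by move=> cL L0; apply: second_category_DBSC => //; exact: H.
  have := DBSC_cover_setT sepK md dK rel.
  move=> /DBSC_cover_sequence[C [cC fC Ccov]].
  have [u [v [[lu lv] uv0 fE]]] := DBSC_closed_cover_lsc cC fC Ccov.
  exact: (lsc_difference_DSC md dK lu lv uv0 fE).
Qed.
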